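(* For any $n\ge1$ and $\lambda\in(0,1)$, $$\mathbb E\,Q_1=n\lambda,$$ $$\mathbb E\,Q_i=n\lambda\,\mathbb P(Q_1=\dots=Q_{i-1}=n),\qquad i>1 .$$
   Context: Join the Shortest Queue system: there are $n$ identical servers, Poisson arrivals with rate $n\lambda$, and i.i.d. exponential rate-$1$ service times. Each server has its own infinite buffer. An arriving customer goes to an idle server if one is available; otherwise the customer is routed to a server with the smallest number of customers in its buffer (ties broken arbitrarily). Customers do not switch servers. $Q_i(t)$ is the number of servers with at least $i$ customers at time $t$. $\{(Q_i(t))_{i\ge1}\}_{t\ge0}$ is a positive recurrent continuous-time Markov chain on $$S=\Big\{q\in\{0,\dots,n\}^\infty: q_i\ge q_{i+1},\ \sum_{i\ge1}q_i<\infty\Big\}.$$ Its transitions are: $q\to q+e^{(1)}$ at rate $n\lambda1(q_1<n)$; $q\to q+e^{(i)}$ at rate $n\lambda1(q_1=\dots=q_{i-1}=n,\ q_i<n)$ for $i\ge2$; $q\to q-e^{(i)}$ at rate $q_i-q_{i+1}$ for $i\ge1$, where $e^{(i)}$ is the $i$th unit vector. $(Q_i)_{i\ge1}$ denotes a random vector with the stationary distribution of this chain. *)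

(* Defs.v *)
From mathcomp Require Import all_boot all_order all_algebra.
From mathcomp Require Import all_classical all_reals all_analysis.

Set Implicit Arguments.
Unset Strict Implicit.
Unset Printing Implicit Defensive.

Import Order.TTheory GRing.Theory Num.Theory.
Import numFieldNormedType.Exports.

Local Open Scope classical_set_scope.
Local Open Scope ring_scope.

(* Coordinates are 0-based: [q i] is the number of servers with at least
   [i.+1] customers, usually written q_(i+1). *)
Definition jsq_state := nat -> nat.

(* Bounded partial sums express the finiteness of the total number of
   customers in the system. *)
Definition jsq_space (n : nat) : set jsq_state :=
  [set q | [/\ forall i, (q i <= n)%N,
               forall i, (q i.+1 <= q i)%N &
               exists B : nat, forall m, (\sum_(i < m) q i <= B)%N]].

Definition add_unit (q : jsq_state) (i : nat) : jsq_state :=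
  fun j => (q j + (j == i))%N.

(* The subtraction truncates only if [q i = 0]; on [jsq_space] the rate
   [departure_rate q i] of that move is then 0. *)
Definition sub_unit (q : jsq_state) (i : nat) : jsq_state :=
  fun j => (q j - (j == i))%N.

Section Rates.
Context {R : realType}.
Variables (n : nat) (lam : R).

Definition arrival_rate (q : jsq_state) (i : nat) : R :=
  n%:R * lam * ([forall j : 'I_i, q j == n] && (q i < n)%N)%:R.

Definition departure_rate (q : jsq_state) (i : nat) : R :=
  (q i)%:R - (q i.+1)%:R.

(* For x <> y this is the rate of the transition x -> y. On [jsq_space] the
   sums below have finitely many nonzero terms, as [\sum_(i \in _)] requires. *)
Definition jsq_rate (x y : jsq_state) : R :=
  \sum_(i \in [set: nat])
    (arrival_rate x i * (y == add_unit x i)%:R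
     + departure_rate x i * (y == sub_unit x i)%:R).

Definition jsq_exit_rate (x : jsq_state) : R :=
  \sum_(i \in [set: nat]) (arrival_rate x i + departure_rate x i).

End Rates.

Section MarkovChain.
Context {R : realType} {T : choiceType}.
Variables (S : set T) (p : R -> T -> T -> R).

(* [p t x y] is the probability of being in y at time t when started in x. *)
Record transition_function : Prop := TransitionFunction {
  tf_ge0 : forall t x y, 0 <= t -> S x -> S y -> 0 <= p t x y ;
  tf_sum1 : forall t x, 0 <= t -> S x ->
    \esum_(y in S) (p t x y)%:E = 1%E ;
  tf_init : forall x y, S x -> S y -> p 0 x y = (x == y)%:R ;
  tf_chapman_kolmogorov : forall s t x z, 0 <= s -> 0 <= t -> S x -> S z ->
    \esum_(y in S) (p s x y * p t y z)%:E = (p (s + t) x z)%:E }.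

Record transition_rates (rate : T -> T -> R) (exit_rate : T -> R) : Prop :=
  TransitionRates {
  tr_jump : forall x y, S x -> S y -> x <> y ->
    p h x y / h @[h --> 0^'+] --> rate x y ;
  tr_exit : forall x, S x ->
    (1 - p h x x) / h @[h --> 0^'+] --> exit_rate x }.

Record stationary_distribution (mu : T -> R) : Prop :=
  StationaryDistribution {
  sd_ge0 : forall x, S x -> 0 <= mu x ;
  sd_sum1 : \esum_(x in S) (mu x)%:E = 1%E ;
  sd_invariant : forall t y, 0 <= t -> S y ->
    \esum_(x in S) (mu x * p t x y)%:E = (mu y)%:E }.

End MarkovChain.

(* [p] is the transition function of the Markov chain of queue lengths under
   Join the Shortest Queue, with n servers and arrival rate n * lam. *)
Definition jsq_chain {R : realType} (n : nat) (lam : R)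
    (p : R -> jsq_state -> jsq_state -> R) : Prop :=
  transition_function (jsq_space n) p /\
  transition_rates (jsq_space n) p (jsq_rate n lam) (jsq_exit_rate n lam).

(* Main.v *)
Require Import Defs.
From mathcomp Require Import all_boot all_order all_algebra.
From mathcomp Require Import all_classical all_reals all_analysis.
From mathcomp Require Import measurable_realfun ring lra.

Set Implicit Arguments.
Unset Strict Implicit.
Unset Printing Implicit Defensive.

Import Order.TTheory GRing.Theory Num.Theory.
Import numFieldNormedType.Exports.

Local Open Scope classical_set_scope.
Local Open Scope ring_scope.

(* Let T_i = q_i + q_(i+1) + ... be the number of customers in position at
   least i of their queue. In stationarity the probability flux from
   {T_i <= M} to {T_i > M} equals the reverse flux. Only an arrival that finds
   Q_1 = ... = Q_(i-1) = n raises T_i, always by one, and T_i falls by one at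
   total rate Q_i; hence
     n lam P(Q_1 = ... = Q_(i-1) = n, T_i = M) = E[Q_i; T_i = M + 1],
   and summing over M gives the claim, because Q_i = 0 when T_i = 0. Cutting
   at level sets avoids any integrability question for the unbounded T_i.
   The flux identity is the derivative at t = 0 of
   sum_(x in A) mu(x) p_t(x, A^c) = sum_(x in A^c) mu(x) p_t(x, A);
   dominated convergence applies since the exit rates are bounded and
   p_t(x, A) / t never exceeds the exit rate of x when x is not in A. *)

(** * Sums and integrals against a countably supported law *)

Section ExtendedSums.
Context {R : realType} {T : choiceType}.
Implicit Types (A B : set T) (f : T -> \bar R) (c : R).
Local Open Scope ereal_scope.

Lemma le_esum_set A B f : A `<=` B -> \esum_(x in A) f x <= \esum_(x in B) f x.
Proof.
move=> AB; apply: ge_ereal_sup => _ [X [finX XA] <-].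
by apply: esum_ge; exists X => //; split => //; exact: subset_trans AB.
Qed.

Lemma sum_le_esum A f (s : seq T) : uniq s -> (forall x, x \in s -> A x) ->
  \sum_(x <- s) f x <= \esum_(x in A) f x.
Proof.
move=> us sA; apply: esum_ge; exists [set` s] => //.
by rewrite (fsbig_seq _ _ us).
Qed.

Lemma term_le_esum A f x : A x -> f x <= \esum_(y in A) f y.
Proof.
move=> Ax; have -> : f x = \sum_(y <- [:: x]) f y by rewrite big_seq1.
by apply: sum_le_esum => // y; rewrite inE => /eqP ->.
Qed.

Lemma esumZl A f c : (0 <= c)%R -> (forall x, A x -> 0 <= f x) ->
  \esum_(x in A) (c%:E * f x) = c%:E * \esum_(x in A) f x.
Proof.
(* One inequality for every constant suffices: the reverse one is the same inequality for [c^-1],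
   and [c = 0] is treated apart. *)
have le (c' : R) g : (0 <= c')%R -> (forall x, A x -> 0 <= g x) ->
    \esum_(x in A) (c'%:E * g x) <= c'%:E * \esum_(x in A) g x.
  move=> c0 g0; apply: ge_ereal_sup => _ [X [finX XA] <-].
  rewrite fsbig_finite//= big_seq -ge0_sume_distrr; last first.
    by move=> x; rewrite in_fset_set// inE => /XA/g0.
  rewrite -big_seq -fsbig_finite//.
  apply: lee_wpmul2l; first by rewrite lee_fin.
  by apply: esum_ge; exists X.
move=> c0 f0; apply/eqP; rewrite eq_le le//=.
have [->|cn0] := eqVneq c 0%R.
  by rewrite mul0e; apply: esum_ge0 => x _; rewrite mul0e.
have cV0 : (0 <= c^-1)%R by rewrite invr_ge0.
rewrite -(@lee_pmul2l _ c^-1%:E)// ?lte_fin ?lt_def ?invr_eq0 ?cn0//.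
rewrite muleA -EFinM mulVf// mul1e.
apply: le_trans (le _ _ cV0 _); last by move=> x /f0 ?; exact: mule_ge0.
by apply: le_esum => x Ax; rewrite muleA -EFinM mulVf// mul1e.
Qed.

End ExtendedSums.

Lemma exchange_esum {R : realType} {T U : choiceType} (A : set T) (B : set U)
    (f : T -> U -> \bar R) :
  (forall x y, A x -> B y -> 0 <= f x y)%E ->
  (\esum_(x in A) \esum_(y in B) f x y = \esum_(y in B) \esum_(x in A) f x y)%E.
Proof.
move=> f0; rewrite !esum_esum//; last by move=> *; exact: f0.
rewrite (reindex_esum (B `*`` fun=> A) _ (fun u => (u.2, u.1)))//; split => //=.
- by move=> [y x] [].
- by move=> [y x] [y' x'] _ _ [-> ->].
- by move=> [x y] [/= Ax By]; exists (y, x).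
Qed.

(** * Integration of functions of a countably valued random state *)

Section CountablyValued.
Context {R : realType} {T : choiceType} (S : set T) (mu : T -> R).
Context d (Omega : measurableType d) (P : probability Omega R) (Q : Omega -> T).
Hypothesis S_countable : countable S.
Hypothesis Q_measurable : forall x, S x -> measurable [set w | Q w = x].
Hypothesis Q_law : forall x, S x -> P [set w | Q w = x] = (mu x)%:E.
Local Open Scope ereal_scope.

(** The fibres of an injection of [A] into [nat] have at most one element; indexed by their value,
    they form a disjoint sequence to which countable additivity applies. *)
Let law_partition (A : set T) : A `<=` S -> exists E : nat -> set T,
  [/\ A = \bigcup_k E k, trivIset setT E &
      forall k, E k = set0 \/ exists2 x, S x & E k = [set x]].
Proof.
move=> AS; have : countable A by exact: sub_countable (subset_card_le AS) _.
move=> /countable_injP[f finj].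
exists (fun k => [set x | A x /\ f x = k]); split.
- apply/seteqP; split => [x Ax|x [k _ []//]].
  by exists (f x).
- apply/trivIsetP => i j _ _ /eqP ij; apply/seteqP; split => //.
  move=> x [[_ fi] [_ fj]].
  by apply: ij; rewrite -fi.
- move=> k; have [->|/set0P[x [Ax fx]]] :=
      eqVneq [set x | A x /\ f x = k] set0; first by left.
  right; exists x; first exact: AS.
  apply/seteqP; split=> [y [Ay fy]|y ->//].
  by apply: finj; rewrite ?inE// fx.
Qed.

Lemma measurable_preimage_law (A : set T) : A `<=` S -> measurable (Q @^-1` A).
Proof.
move=> /law_partition[E [-> _ EE]]; rewrite preimage_bigcup.
apply: bigcupT_measurable => k; case: (EE k) => [->|[x Sx ->]].
  by rewrite preimage_set0.
exact: Q_measurable.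
Qed.

(** [T] carries no sigma-algebra; every subset of the countable [S] has a measurable preimage, so an
    arbitrary [g] is measurable after composition with [Q]. *)
Lemma measurable_fun_law (A : set T) (g : T -> \bar R) : A `<=` S ->
  measurable_fun (Q @^-1` A) (fun w => g (Q w)).
Proof.
move=> AS _ Y mY.
have -> : Q @^-1` A `&` (fun w => g (Q w)) @^-1` Y =
    Q @^-1` (A `&` g @^-1` Y) by [].
by apply: measurable_preimage_law => x [/AS].
Qed.

Lemma integral_law (A : set T) (g : T -> \bar R) : A `<=` S ->
  (forall x, A x -> 0 <= g x) ->
  \int[P]_(w in Q @^-1` A) g (Q w) = \esum_(x in A) (g x * (mu x)%:E).
Proof.
move=> AS g0; have [E [AE tE EE]] := law_partition AS.
have mu0 x : S x -> 0 <= (mu x)%:E by move=> /Q_law <-.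
have h0 x : A x -> 0 <= g x * (mu x)%:E.
  by move=> Ax; rewrite mule_ge0// ?g0// mu0//; exact: AS.
have EA k : E k `<=` A by rewrite AE; exact: bigcup_sup.
have QAE : Q @^-1` A = \bigcup_k (Q @^-1` E k) by rewrite AE preimage_bigcup.
rewrite QAE ge0_integral_bigcup//; first last.
- move: tE => /trivIsetP tE; apply/trivIsetP => i j _ _ ij.
  by rewrite -preimage_setI tE// preimage_set0.
- by rewrite -QAE => w; exact: g0.
- by rewrite -QAE; exact: measurable_fun_law.
- by move=> k; apply: measurable_preimage_law; exact: subset_trans AS.
rewrite [in RHS]AE esum_bigcup//; first last.
- by move=> x; rewrite -AE; exact: h0.
- exact: sub_trivIset tE.
rewrite nneseries_esumT; last first.
  by move=> k; apply: integral_ge0 => w /EA; exact: g0.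
apply: eq_esum => k _; case: (EE k) => [E0|[x Sx Ex]].
  by rewrite E0 preimage_set0 integral_set0 esum_set0.
have Ax : A x by apply: (EA k); rewrite Ex.
rewrite Ex esum_set1; last exact: h0.
rewrite (_ : Q @^-1` [set x] = [set w | Q w = x])// -Q_law//.
rewrite -integral_cst; last exact: Q_measurable.
by apply: eq_integral => w /[!inE] /= ->.
Qed.

(** The law is prescribed only at points of [S]; as it has total mass 1 there, the rest is a null
    event. *)
Lemma law_ae : \esum_(x in S) (mu x)%:E = 1 -> {ae P, forall w, S (Q w)}.
Proof.
move=> mu1; exists (Q @^-1` (~` S)); split => //.
- by rewrite preimage_setC; apply/measurableC/measurable_preimage_law.
- rewrite preimage_setC probability_setC; last exact: measurable_preimage_law.
  rewrite -[P (Q @^-1` S)]mul1e -integral_cst;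
    last exact: measurable_preimage_law.
  rewrite (integral_law (g := cst 1))// (_ : esum _ _ = 1) ?subee//.
  by rewrite -[RHS]mu1; apply: eq_esum => x _; rewrite /= mul1e.
Qed.

End CountablyValued.

(** * Balance of stationary probability flux *)

Section TransitionFunction.
Context {R : realType} {T : choiceType} (S : set T) (p : R -> T -> T -> R).
Hypothesis p_transition : transition_function S p.

Let p_ge0 := tf_ge0 p_transition.

Lemma tf_partial_sum_le1 t x (s : seq T) : 0 <= t -> S x -> uniq s ->
  (forall y, y \in s -> S y) -> \sum_(y <- s) p t x y <= 1.
Proof.
move=> t0 Sx us sS; rewrite -lee_fin -sumEFin -(tf_sum1 p_transition t0 Sx).
exact: sum_le_esum.
Qed.

Lemma tf_stay_le1 t x : 0 <= t -> S x -> p t x x <= 1.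
Proof.
move=> t0 Sx; have := @tf_partial_sum_le1 t x [:: x] t0 Sx isT.
by rewrite big_seq1; apply => y; rewrite inE => /eqP ->.
Qed.

(** Keeping only the term [y = x] in Chapman-Kolmogorov gives p_2h(x, x) >= p_h(x, x)^2, and 1 - a^2
    <= 2 (1 - a). *)
Lemma tf_leave_double h x : 0 <= h -> S x ->
  1 - p (h + h) x x <= 2 * (1 - p h x x).
Proof.
move=> h0 Sx; have : p h x x * p h x x <= p (h + h) x x.
  rewrite -lee_fin -(tf_chapman_kolmogorov p_transition h0 h0 Sx Sx).
  exact: (term_le_esum (fun y => (p h x y * p h y x)%:E)).
have := tf_stay_le1 h0 Sx; have := p_ge0 h0 Sx Sx; nra.
Qed.

(* By [tf_leave_double] the quotient does not decrease when h is halved. *)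
Lemma tf_leave_rate_le c h x : S x ->
  (1 - p h x x) / h @[h --> 0^'+] --> c -> 0 < h -> (1 - p h x x) / h <= c.
Proof.
move=> Sx /cvg_at_rightP cvg_c h0.
pose u : nat -> R := geometric h 2^-1.
have u0 k : 0 < u k by rewrite mulr_gt0// exprn_gt0// invr_gt0.
have /cvg_c : (forall k, u k > 0) /\ u k @[k --> \oo] --> 0.
  split => //; apply: cvg_geometric.
  by rewrite ger0_norm ?invr_ge0// invf_lt1// ltr1n.
move=> /cvgr_to_ge; apply; apply: nearW => k.
elim: k => [|k IH]; first by rewrite /u /= expr0 mulr1.
apply: le_trans IH _.
have -> : u k = u k.+1 + u k.+1.
  by rewrite /u /= exprS; field.
rewrite ler_pdivrMr ?addr_gt0//.
apply: le_trans (tf_leave_double (ltW (u0 _)) Sx) _.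
by rewrite [leRHS]mulrDr divfK ?gt_eqF// mulr_natl mulr2n.
Qed.

Lemma tf_set_le1 t x A : 0 <= t -> S x -> A `<=` S ->
  (0 <= \esum_(y in A) (p t x y)%:E <= 1)%E.
Proof.
move=> t0 Sx AS; apply/andP; split.
  by apply: esum_ge0 => y /AS Sy; rewrite lee_fin p_ge0.
by rewrite -(tf_sum1 p_transition t0 Sx); exact: le_esum_set.
Qed.

Lemma tf_set_fin t x A : 0 <= t -> S x -> A `<=` S ->
  \esum_(y in A) (p t x y)%:E \is a fin_num.
Proof.
move=> t0 Sx AS; have /andP[p0 p1] := tf_set_le1 t0 Sx AS.
by rewrite ge0_fin_numE//; apply: le_lt_trans p1 (ltry _).
Qed.

Lemma tf_set_add_le1 t x A (s : seq T) : 0 <= t -> S x -> A `<=` S ->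
  uniq s -> (forall y, y \in s -> S y /\ ~ A y) ->
  fine (\esum_(y in A) (p t x y)%:E) + \sum_(y <- s) p t x y <= 1.
Proof.
move=> t0 Sx AS us sA.
rewrite -lee_fin EFinD fineK ?tf_set_fin// -sumEFin.
rewrite -(tf_sum1 p_transition t0 Sx) (esumID A S); last first.
  by move=> y Sy; rewrite lee_fin p_ge0.
by rewrite setIidr//; apply: leeD => //; exact: sum_le_esum.
Qed.

(** A chain found in [A] is not at [x], so p_h(x, A) <= 1 - p_h(x, x). The bound is uniform in [h]
    and provides the domination. *)
Lemma tf_set_rate_le c x A : S x -> A `<=` S -> ~ A x ->
  (1 - p h x x) / h @[h --> 0^'+] --> c ->
  forall h, 0 < h -> fine (\esum_(y in A) (p h x y)%:E) / h <= c.
Proof.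
move=> Sx AS nAx cvg_c h h0; apply: le_trans (tf_leave_rate_le Sx cvg_c h0).
rewrite ler_pM2r ?invr_gt0// lerBrDr.
have := @tf_set_add_le1 h x A [:: x] (ltW h0) Sx AS isT.
by rewrite big_seq1; apply => y; rewrite inE => /eqP ->.
Qed.

Lemma cvg_sum_seq (F : set_system R) (FF : Filter F) (s : seq T) (P : pred T)
    (f : T -> R -> R) (l : T -> R) :
  (forall y, y \in s -> f y h @[h --> F] --> l y) ->
  \sum_(y <- s | P y) f y h @[h --> F] --> \sum_(y <- s | P y) l y.
Proof.
move=> fl; rewrite big_seq_cond; under eq_fun do rewrite big_seq_cond.
apply: cvg_big => [|y /andP[ys _]]; last exact: fl.
exact: add_continuous.
Qed.

(* As [s] carries the whole exit rate, the mass that escapes from [x] without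
   entering [s] is o(h): this gives the upper bound of the squeeze. *)
Lemma tf_set_rate_cvg x A (s : seq T) (q : T -> R) : S x -> A `<=` S -> ~ A x ->
  uniq s -> (forall y, y \in s -> S y /\ y != x) ->
  (forall y, y \in s -> p h x y / h @[h --> 0^'+] --> q y) ->
  (1 - p h x x) / h @[h --> 0^'+] --> \sum_(y <- s) q y ->
  fine (\esum_(y in A) (p h x y)%:E) / h @[h --> 0^'+] -->
    \sum_(y <- s | y \in A) q y.
Proof.
move=> Sx AS nAx us sS cvg_q cvg_exit.
apply: (@squeeze_cvgr _ _ _ _
  (fun h => \sum_(y <- s | y \in A) p h x y / h)
  (fun h => (1 - p h x x) / h - \sum_(y <- s | y \notin A) p h x y / h)).
- near=> h; have h0 : 0 < h by near: h; exact: nbhs_right_gt.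
  rewrite -!mulr_suml -mulrBl !ler_pM2r ?invr_gt0//; apply/andP; split.
    rewrite -lee_fin fineK ?tf_set_fin ?(ltW h0)// -big_filter -sumEFin.
    apply: sum_le_esum; first exact: filter_uniq.
    by move=> y; rewrite mem_filter => /andP[/set_mem].
  (* Upper bound: [A], the state [x] and the listed states outside [A] are disjoint, so their masses
     add up to at most 1. *)
  rewrite -addrA -opprD lerBrDr -big_filter.
  have := @tf_set_add_le1 h x A (x :: [seq y <- s | y \notin A]) (ltW h0) Sx AS.
  rewrite big_cons; apply.
    rewrite /= filter_uniq// andbT mem_filter; apply/negP => /andP[_ /sS[_]].
    by rewrite eqxx.
  move=> y; rewrite inE => /orP[/eqP ->//|].
  by rewrite mem_filter => /andP[+ /sS[]]; rewrite notin_setE.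
- exact: cvg_sum_seq.
- rewrite [X in _ --> X](_ : _ =
      \sum_(y <- s) q y - \sum_(y <- s | y \notin A) q y); last first.
    by rewrite (bigID (mem A) xpredT) /= addrK.
  by apply: cvgB => //; exact: cvg_sum_seq.
Unshelve. all: by end_near. Qed.

(** Both [F A S] and [F S A] equal mu(A): the first because the rows of p_t sum to 1, the second by
    invariance. Removing the common part [F A A] leaves the two flows. *)
Lemma stationary_flow mu t A : stationary_distribution S p mu -> 0 <= t ->
  A `<=` S ->
  (\esum_(x in A) ((mu x)%:E * \esum_(y in S `\` A) (p t x y)%:E) =
   \esum_(x in S `\` A) ((mu x)%:E * \esum_(y in A) (p t x y)%:E))%E.
Proof.
move=> hmu t0 AS; pose B := S `\` A.
have BS : B `<=` S by move=> x [].
have mu0 := sd_ge0 hmu.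
pose F X Y := (\esum_(x in X) \esum_(y in Y) ((mu x)%:E * (p t x y)%:E))%E.
have f0 x y : S x -> S y -> (0 <= (mu x)%:E * (p t x y)%:E)%E.
  by move=> Sx Sy; rewrite mule_ge0// lee_fin ?mu0// p_ge0.
have FE X Y : X `<=` S -> Y `<=` S ->
    F X Y = (\esum_(x in X) ((mu x)%:E * \esum_(y in Y) (p t x y)%:E))%E.
  move=> XS YS; apply: eq_esum => x /XS Sx; rewrite esumZl ?mu0// => y /YS Sy.
  by rewrite lee_fin p_ge0.
rewrite -!FE//.
have row : (F A S = F A A + F A B)%E.
  rewrite /F -esumD; last 2 first.
  - by move=> x /AS Sx; apply: esum_ge0 => y /AS; exact: f0.
  - by move=> x /AS Sx; apply: esum_ge0 => y /BS; exact: f0.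
  apply: eq_esum => x /AS Sx; rewrite (esumID A S)//; last first.
    by move=> y; exact: f0.
  by rewrite setIidr.
have col : (F S A = F A A + F B A)%E.
  rewrite /F (esumID A S) ?(setIidr AS)// => x Sx.
  by apply: esum_ge0 => y /AS; exact: f0.
have AA : F A S = (\esum_(x in A) (mu x)%:E)%E.
  rewrite FE//; apply: eq_esum => x /AS Sx.
  by rewrite (tf_sum1 p_transition t0 Sx) mule1.
have SA : F S A = (\esum_(x in A) (mu x)%:E)%E.
  rewrite /F exchange_esum; last by move=> x y Sx /AS; exact: f0.
  by apply: eq_esum => y /AS Sy; rewrite -(sd_invariant hmu t0 Sy).
have FAA0 : (0 <= F A A)%E.
  by apply: esum_ge0 => x /AS Sx; apply: esum_ge0 => y /AS; exact: f0.
have FAB0 : (0 <= F A B)%E.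
  by apply: esum_ge0 => x /AS Sx; apply: esum_ge0 => y /BS; exact: f0.
(* Cancelling in the extended reals requires finiteness; here mu(S) = 1 is a bound. *)
have FAAfin : F A A \is a fin_num.
  rewrite ge0_fin_numE//; apply: (@le_lt_trans _ _ 1%E); last exact: ltry.
  rewrite -(sd_sum1 hmu); apply: (@le_trans _ _ (F A S)).
    by rewrite row leeDl.
  by rewrite AA; exact: le_esum_set.
have e : (F A B + F A A = F B A + F A A)%E.
  by rewrite addeC -row AA -SA col addeC.
transitivity (F A B + F A A - F A A)%E; first by rewrite addeK.
by rewrite e addeK.
Qed.

End TransitionFunction.

(** * Flux rates as limits of transition probabilities over short times *)

Section FluxBalance.
Context {R : realType} {T : choiceType} (S : set T) (p : R -> T -> T -> R).
Context (mu : T -> R) d (Omega : measurableType d) (P : probability Omega R).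
Context (Q : Omega -> T) (N : T -> seq T) (q : T -> T -> R) (C : R).
Hypothesis S_countable : countable S.
Hypothesis Q_measurable : forall x, S x -> measurable [set w | Q w = x].
Hypothesis Q_law : forall x, S x -> P [set w | Q w = x] = (mu x)%:E.
Hypothesis p_transition : transition_function S p.
Hypothesis mu_stationary : stationary_distribution S p mu.
Hypothesis N_uniq : forall x, S x -> uniq (N x).
Hypothesis N_neighbour : forall x y, S x -> y \in N x -> S y /\ y != x.
Hypothesis N_rate : forall x y, S x -> y \in N x ->
  p h x y / h @[h --> 0^'+] --> q x y.
Hypothesis N_exit : forall x, S x ->
  (1 - p h x x) / h @[h --> 0^'+] --> \sum_(y <- N x) q x y.
Hypothesis exit_bounded : forall x, S x -> \sum_(y <- N x) q x y <= C.
Local Open Scope ereal_scope.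

(** Dominated convergence along the times 1/(k+1) for the quotients [f k], which are bounded by the
    constant [C], integrable under a probability. *)
Lemma cvg_flux (A B : set T) : A `<=` S -> B `<=` S -> A `&` B `<=` set0 ->
  ((harmonic k)^-1%:E *
    \esum_(x in A) ((mu x)%:E * \esum_(y in B) (p (harmonic k) x y)%:E))
    @[k --> \oo] -->
  \int[P]_(w in Q @^-1` A) (\sum_(y <- N (Q w) | y \in B) q (Q w) y)%R%:E.
Proof.
move=> AS BS AB0.
pose f (k : nat) x :=
  (fine (\esum_(y in B) (p (harmonic k) x y)%:E) / harmonic k)%R%:E.
have h0 k : (0 < harmonic k :> R)%R := harmonic_gt0 k.
have nB x : A x -> ~ B x by move=> Ax Bx; exact: (AB0 x).
have f0 k x : A x -> 0 <= f k x.
  move=> /AS Sx; rewrite lee_fin divr_ge0 ?(ltW (h0 k))// fine_ge0//.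
  by have /andP[] := tf_set_le1 p_transition (ltW (h0 k)) Sx BS.
have [||||||] := @dominated_convergence _ _ _ P (Q @^-1` A) _
  (fun k w => f k (Q w))
  (fun w => (\sum_(y <- N (Q w) | y \in B) q (Q w) y)%R%:E) (EFin \o cst C).
- exact: (measurable_preimage_law S_countable Q_measurable AS).
- move=> k.
  exact: (measurable_fun_law S_countable Q_measurable (f k) AS).
- exact: (measurable_fun_law S_countable Q_measurable
    (fun x => (\sum_(y <- N x | y \in B) q x y)%R%:E) AS).
- apply: aeW => w /= Aw; apply: cvg_EFin; first exact: nearW.
  have /cvg_at_rightP := tf_set_rate_cvg p_transition (AS _ Aw) BS (nB _ Aw)
    (N_uniq (AS _ Aw)) (fun y => N_neighbour (AS _ Aw))
    (fun y => N_rate (AS _ Aw)) (N_exit (AS _ Aw)).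
  by apply; split => //; exact: cvg_harmonic.
- apply: finite_measure_integrable_cst.
  exact: (measurable_preimage_law S_countable Q_measurable AS).
- apply: aeW => w k Aw; rewrite gee0_abs; last exact: f0.
  rewrite lee_fin.
  apply: le_trans (exit_bounded (AS _ Aw)).
  exact: (tf_set_rate_le p_transition (AS _ Aw) BS (nB _ Aw)
    (N_exit (AS _ Aw)) (h0 k)).
(* The sums of the statement are the integrals of the [f k]. *)
move=> _ _; apply: cvg_trans; apply: near_eq_cvg; apply: nearW => k /=.
rewrite (integral_law S_countable Q_measurable Q_law AS (f0 k)) -esumZl.
- apply: eq_esum => x /AS Sx; rewrite /f.
  have Ep := fineK (tf_set_fin p_transition (ltW (h0 k)) Sx BS).
  by rewrite -Ep -!EFinM; congr (_%:E); ring.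
- by rewrite invr_ge0 ltW.
- move=> x /AS Sx; rewrite mule_ge0 ?lee_fin ?(sd_ge0 mu_stationary)//.
  by have /andP[] := tf_set_le1 p_transition (ltW (h0 k)) Sx BS.
Qed.

(** By [stationary_flow] both sides are limits of one and the same sequence. *)
Lemma flux_balance (A : set T) : A `<=` S ->
  \int[P]_(w in Q @^-1` A)
    (\sum_(y <- N (Q w) | y \in S `\` A) q (Q w) y)%R%:E =
  \int[P]_(w in Q @^-1` (S `\` A))
    (\sum_(y <- N (Q w) | y \in A) q (Q w) y)%R%:E.
Proof.
move=> AS; have BS : S `\` A `<=` S by move=> x [].
have AB : A `&` (S `\` A) `<=` set0 by move=> x [Ax [_ /(_ Ax)]].
have BA : (S `\` A) `&` A `<=` set0 by rewrite setIC.
have := cvg_flux AS BS AB; have := cvg_flux BS AS BA.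
under eq_fun do rewrite -(stationary_flow p_transition mu_stationary
  (harmonic_ge0 _) AS).
by move=> cvgBA cvgAB; exact: cvg_unique cvgAB cvgBA.
Qed.

End FluxBalance.

(** * Join the Shortest Queue *)

(** Stated for a general operation, to serve both for [tail] in [nat] and for rates in [R]. *)
Lemma big_setT_ord (M : Type) (idx : M) (op : Monoid.com_law idx) (F : nat -> M)
    B : (forall i, (B <= i)%N -> F i = idx) ->
  \big[op/idx]_(i \in [set: nat]) F i = \big[op/idx]_(i < B) F i.
Proof.
move=> F0; rewrite (fsbigE (iota 0 B)) ?iota_uniq//.
  by rewrite -(big_mkord xpredT F) /index_iota subn0; apply: eq_bigl => i;
    rewrite in_setT.
by move=> i _; rewrite mem_iota /= add0n -leqNgt => /F0.
Qed.

(** * The state space, tails of the queues and unit moves *)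

Section JsqSpace.
Variable n : nat.
Implicit Types (x y : jsq_state) (i j B : nat).

Definition zero_from B x := forall j, (B <= j)%N -> x j = 0%N.

Lemma jsq_space_antitone x i j : jsq_space n x -> (i <= j)%N -> (x j <= x i)%N.
Proof.
move=> [_ anti _]; elim: j => [|j IH]; first by rewrite leqn0 => /eqP ->.
rewrite leq_eqVlt => /orP[/eqP ->//|]; rewrite ltnS => /IH.
exact: leq_trans.
Qed.

(** If [x B] were positive, monotonicity would make the first [B.+1] coordinates positive and their
    sum exceed [B]. Conversely [B * n] bounds all partial sums. *)
Lemma jsq_spaceP x : jsq_space n x <->
  [/\ forall i, (x i <= n)%N, forall i, (x i.+1 <= x i)%N &
      exists B, zero_from B x].
Proof.
split=> [Sx|[xn anti [B xB]]].
  have [xn anti [B sumB]] := Sx; split => //; exists B => j Bj.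
  apply/eqP; rewrite -leqn0; apply: leq_trans (jsq_space_antitone Sx Bj) _.
  rewrite leqNgt; apply/negP => xB0; have := sumB B.+1.
  rewrite leqNgt => /negP; apply.
  rewrite -{1}[B.+1]card_ord -sum1_card; apply: leq_sum => i _.
  by apply: leq_trans xB0 _; apply: jsq_space_antitone => //; rewrite -ltnS.
split => //; exists (B * n)%N => m.
apply: (@leq_trans (\sum_(i < m) (if (i < B)%N then n else 0))).
  apply: leq_sum => i _; case: ltnP => // Bi.
  by rewrite xB.
rewrite -(big_mkord xpredT (fun i => if (i < B)%N then n else 0%N)).
apply: (@leq_trans (\sum_(0 <= i < m + B) (if (i < B)%N then n else 0))).
  by rewrite (@big_cat_nat _ _ _ m 0 (m + B)%N)//= ?leq_addr// leq_addr.
rewrite (@big_cat_nat _ _ _ B 0 (m + B)%N)//= ?leq_addl//.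
rewrite [X in (_ + X <= _)%N]big1_seq ?addn0; last first.
  move=> i; rewrite mem_index_iota => /andP[_ /andP[Bi _]].
  by rewrite ltnNge Bi.
rewrite (eq_big_nat _ _ (F2 := fun=> n)); last by move=> i /andP[_ ->].
by rewrite sum_nat_const_nat subn0.
Qed.

(** Each state is a finite sequence padded with zeros. *)
Lemma jsq_space_countable : countable (jsq_space n).
Proof.
apply: (sub_countable _ (countableP [set: seq nat])).
apply: card_le_trans (card_image_le (fun s j => nth 0%N s j) _).
apply: subset_card_le => x /jsq_spaceP[_ _ [B xB]].
exists (mkseq x B) => //; apply/funext => j.
case: (ltnP j B) => jB; first by rewrite nth_mkseq.
by rewrite nth_default ?size_mkseq// xB.
Qed.

(* Meaningful on [jsq_space n] only: 0 for a state without a zero tail. *)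
Definition horizon x : nat := xget 0%N [set B | zero_from B x].

Lemma horizonP x : jsq_space n x -> zero_from (horizon x) x.
Proof.
move=> /jsq_spaceP[_ _ [B xB]]; rewrite /horizon.
by case: xgetP => [_ ->//|/(_ B)].
Qed.

(** Same form as the condition inside [arrival_rate]; vacuous for [i = 0]. *)
Definition full i x := [forall j : 'I_i, x j == n].

Lemma fullP i x : reflect (forall j, (j < i)%N -> x j = n) (full i x).
Proof.
apply: (iffP forallP) => [xn j ji|xn j]; first exact: eqP (xn (Ordinal ji)).
by rewrite xn.
Qed.

Lemma fullS i x : full i.+1 x = full i x && (x i == n).
Proof.
apply/fullP/andP => [xn|[/fullP xn /eqP xi] j].
  by split; [apply/fullP => j ji; apply: xn; exact: ltnW|rewrite xn].
by rewrite ltnS leq_eqVlt => /orP[/eqP ->//|]; exact: xn.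
Qed.

(** This is T_(i+1) in 1-based notation. Summing over all of [nat] frees it from the horizon, which
    a move may change. *)
Definition tail i x : nat :=
  \big[addn/0%N]_(j \in [set: nat]) (if (i <= j)%N then x j else 0%N).

Lemma tailE i x B : zero_from B x ->
  tail i x = (\sum_(j < B | (i <= j)%N) x j)%N.
Proof.
move=> xB; rewrite /tail (big_setT_ord _ (B := B)) -?big_mkcond//.
by move=> j /xB ->; case: ifP.
Qed.

(** Makes level 0 of the tail contribute nothing to the expectation of coordinate [i]. *)
Lemma tail_eq0 i x : jsq_space n x -> tail i x = 0%N -> x i = 0%N.
Proof.
move=> Sx; have xH := horizonP Sx; rewrite (tailE i xH).
have [/xH //|iH] := leqP (horizon x) i.
by rewrite (bigD1 (Ordinal iH))//= => /eqP; rewrite addn_eq0 => /andP[/eqP].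
Qed.

Lemma zero_from_add B x i : zero_from B x ->
  zero_from (maxn B i.+1) (add_unit x i).
Proof.
move=> xB j; rewrite geq_max => /andP[/xB xj ij].
by rewrite /add_unit xj gtn_eqF.
Qed.

Lemma tail_add B x i k : zero_from B x ->
  tail i (add_unit x k) = (tail i x + (i <= k))%N.
Proof.
move=> xB; rewrite (tailE i (@zero_from_add _ _ k xB)).
rewrite (@tailE i x (maxn B k.+1)); last first.
  by move=> j; rewrite geq_max => /andP[/xB].
rewrite /add_unit big_split /=; congr addn.
have kB : (k < maxn B k.+1)%N by rewrite leq_max leqnn orbT.
rewrite (eq_bigr (fun j : 'I__ => if j == Ordinal kB then 1 else 0))%N;
  last first.
  by move=> j _; rewrite -val_eqE /=; case: eqP.
rewrite -big_mkcondr /= sum1_card.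
case: leqP => ik; last first.
  apply: eq_card0 => j; apply/negP => /andP[ij /eqP je].
  by move: ij; rewrite je leqNgt ik.
apply: etrans (card1 (Ordinal kB)); apply: eq_card => j.
by rewrite unfold_in inE andbC; case: eqP => [->|].
Qed.

Lemma sub_unitK x i : (0 < x i)%N -> add_unit (sub_unit x i) i = x.
Proof.
move=> x0; apply/funext => j; rewrite /add_unit /sub_unit.
by case: eqP => [->|_]; rewrite ?subn0 ?addn0// subnK.
Qed.

Lemma zero_from_sub B x i : zero_from B x -> zero_from B (sub_unit x i).
Proof. by move=> xB j /xB; rewrite /sub_unit => ->. Qed.

(** The additive form avoids truncated subtraction and reduces to [tail_add]. *)
Lemma tail_sub B x i k : zero_from B x -> (0 < x k)%N ->
  tail i x = (tail i (sub_unit x k) + (i <= k))%N.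
Proof.
by move=> xB xk; rewrite -(tail_add _ _ (@zero_from_sub _ _ k xB)) sub_unitK.
Qed.

(** Monotonicity is at risk only between positions [i - 1] and [i], where the former already equals
    [n]. *)
Lemma jsq_space_add x i : jsq_space n x -> full i x -> (x i < n)%N ->
  jsq_space n (add_unit x i).
Proof.
move=> /jsq_spaceP[xn anti [B xB]] /fullP xi xin; apply/jsq_spaceP; split.
- move=> j; rewrite /add_unit; case: eqP => [->|_]; last by rewrite addn0.
  by rewrite addn1.
- move=> j; rewrite /add_unit; case: eqP => [ji|_].
    by rewrite -ji in xi xin *; rewrite addn1 (xi j)// ltn_addr.
  by rewrite addn0 (leq_trans (anti j))// leq_addr.
- by exists (maxn B i.+1); exact: zero_from_add.
Qed.

Lemma jsq_space_sub x i : jsq_space n x -> (x i.+1 < x i)%N ->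
  jsq_space n (sub_unit x i).
Proof.
move=> /jsq_spaceP[xn anti [B xB]] xi; apply/jsq_spaceP; split.
- by move=> j; apply: leq_trans (leq_subr _ _) (xn j).
- move=> j; rewrite /sub_unit; have [->|_] := eqVneq j i.
    by rewrite gtn_eqF// subn0 subn1 -ltnS prednK// (leq_ltn_trans _ xi).
  by rewrite subn0; apply: leq_trans (leq_subr _ _) (anti j).
- by exists B; exact: zero_from_sub.
Qed.

Lemma add_unit_inj x : injective (add_unit x).
Proof.
move=> i k /(congr1 (@^~ i)); rewrite /add_unit eqxx => /eqP.
by rewrite eqn_add2l; case: (i =P k).
Qed.

(** Positivity guards against truncation: coordinate [i] really drops, which only [k = i] allows. *)
Lemma sub_unit_inj x i k : (0 < x i)%N -> sub_unit x i = sub_unit x k -> i = k.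
Proof.
move=> xi /(congr1 (@^~ i)); rewrite /sub_unit eqxx; case: eqP => // _.
by move=> /eqP; rewrite subn0 subn1 ltn_eqF// prednK.
Qed.

Lemma add_unit_neq_sub x i k : add_unit x i <> sub_unit x k.
Proof.
move=> /(congr1 (@^~ i)); rewrite /add_unit /sub_unit eqxx addn1 => xi.
by have := leq_subr (i == k) (x i); rewrite -xi ltnn.
Qed.

End JsqSpace.

(** * Jump rates and the flux across a level of the tail *)

Section JsqRates.
Context {R : realType} (n : nat) (lam : R).
Hypothesis n_gt0 : (0 < n)%N.
Implicit Types (x y : jsq_state) (i k B M : nat).

Lemma arrival_rateE x i :
  arrival_rate n lam x i = n%:R * lam * (full n i x && (x i < n)%N)%:R.
Proof. by []. Qed.

Lemma departure_rate_eq0 x i : jsq_space n x -> ~~ (x i.+1 < x i)%N ->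
  departure_rate x i = 0 :> R.
Proof.
move=> [_ anti _]; rewrite -leqNgt => xi.
by rewrite /departure_rate (@anti_leq (x i) (x i.+1)) ?subrr// xi anti.
Qed.

(** Arrivals at distinct positions lead to distinct states, none reached by a departure, so a single
    term of the sum survives. *)
Lemma jsq_rate_add x i : full n i x -> (x i < n)%N ->
  jsq_rate n lam x (add_unit x i) = n%:R * lam.
Proof.
move=> xi xin; rewrite /jsq_rate (fsbigE [:: i])//=.
- rewrite big_mkcond big_seq1 in_setT eqxx arrival_rateE xi xin !mulr1.
  by case: eqP => [/add_unit_neq_sub//|_]; rewrite mulr0 addr0.
- move=> k _; rewrite inE => ki.
  case: eqP => [/add_unit_inj/esym/eqP|_]; first by rewrite (negPf ki).
  by case: eqP => [/add_unit_neq_sub//|_]; rewrite !mulr0 addr0.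
Qed.

Lemma jsq_rate_sub x i : (x i.+1 < x i)%N ->
  jsq_rate n lam x (sub_unit x i) = departure_rate x i.
Proof.
move=> xi; have xi0 : (0 < x i)%N by exact: leq_ltn_trans xi.
rewrite /jsq_rate (fsbigE [:: i])//=.
- rewrite big_mkcond big_seq1 in_setT eqxx mulr1.
  by case: eqP => [/esym/add_unit_neq_sub//|_]; rewrite mulr0 add0r.
- move=> k _; rewrite inE => ki.
  case: eqP => [/esym/add_unit_neq_sub//|_].
  case: eqP => [/(sub_unit_inj xi0)/esym/eqP|_]; first by rewrite (negPf ki).
  by rewrite !mulr0 addr0.
Qed.

(* The filters discard the moves of rate 0. *)
Definition jsq_neighbours x : seq jsq_state :=
  [seq add_unit x i | i <- index_iota 0 (horizon x).+1
                    & full n i x && (x i < n)%N] ++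
  [seq sub_unit x i | i <- index_iota 0 (horizon x).+1 & (x i.+1 < x i)%N].

Lemma jsq_neighbours_uniq x : uniq (jsq_neighbours x).
Proof.
rewrite cat_uniq; apply/and3P; split.
- by rewrite map_inj_uniq ?filter_uniq ?iota_uniq//; exact: add_unit_inj.
- apply/hasPn => _ /mapP[k _ ->]; apply/negP => /mapP[i _ /esym].
  exact: add_unit_neq_sub.
- rewrite map_inj_in_uniq ?filter_uniq ?iota_uniq// => i k.
  rewrite mem_filter => /andP[xi _] _; apply: sub_unit_inj.
  exact: leq_ltn_trans xi.
Qed.

Lemma jsq_neighboursP x y : y \in jsq_neighbours x ->
  (exists i, [/\ full n i x, (x i < n)%N & y = add_unit x i]) \/
  (exists2 i, (x i.+1 < x i)%N & y = sub_unit x i).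
Proof.
rewrite mem_cat => /orP[|] /mapP[i]; rewrite mem_filter => /andP[xi _] ->.
  by left; exists i; have /andP[] := xi.
by right; exists i.
Qed.

Lemma jsq_neighbours_space x y : jsq_space n x -> y \in jsq_neighbours x ->
  jsq_space n y /\ y != x.
Proof.
move=> Sx /jsq_neighboursP[[i [xi xin ->]]|[i xi ->]]; split.
- exact: jsq_space_add.
- apply/eqP => /(congr1 (@^~ i))/eqP.
  by rewrite /add_unit eqxx -{2}[x i]addn0 eqn_add2l.
- exact: jsq_space_sub.
- apply/eqP => /(congr1 (@^~ i))/eqP.
  by rewrite /sub_unit eqxx subn1 ltn_eqF// prednK// (leq_ltn_trans _ xi).
Qed.

(** Sums over states become sums over positions; the moves filtered out have rate 0 and can be put
    back. *)
Lemma sum_jsq_neighbours x (P : pred jsq_state) : jsq_space n x ->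
  \sum_(y <- jsq_neighbours x | P y) jsq_rate n lam x y =
  \sum_(0 <= i < (horizon x).+1 | P (add_unit x i)) arrival_rate n lam x i +
  \sum_(0 <= i < (horizon x).+1 | P (sub_unit x i)) departure_rate x i.
Proof.
move=> Sx.
rewrite big_cat !big_map !big_filter_cond !big_mkcondl; congr (_ + _).
  apply: eq_bigr => i _; rewrite arrival_rateE; case: ifP => [/andP[xi xin]|_].
    by rewrite jsq_rate_add// mulr1.
  by rewrite mulr0.
apply: eq_bigr => i _; case: ifPn => [/jsq_rate_sub //|].
by move=> /(departure_rate_eq0 Sx) ->.
Qed.

(** Coordinate [horizon x] is 0, not [n]. An arrival can still occur at position [horizon x] itself,
    hence the ranges up to [(horizon x).+1]. *)
Lemma not_full x i : jsq_space n x -> (horizon x < i)%N -> full n i x = false.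
Proof.
move=> Sx Hi; apply/negP => /fullP/(_ _ Hi); rewrite (horizonP Sx)// => n0.
by have := n_gt0; rewrite -n0.
Qed.

(** Telescoping: the arrival rate at [k] is [n%:R * lam] times the indicator of [full n k x] minus
    that of [full n k.+1 x], and the last indicator vanishes. *)
Lemma sum_arrival_rate x i : jsq_space n x ->
  \sum_(0 <= k < (horizon x).+1 | (i <= k)%N) arrival_rate n lam x k =
  n%:R * lam * (full n i x)%:R.
Proof.
move=> Sx; have [xn _ _] := Sx.
rewrite -(big_nat_widenl i 0 _ xpredT)//.
have [iH|Hi] := leqP i (horizon x).+1; last first.
  by rewrite big_geq ?not_full ?mulr0 1?ltnW// ltnW.
rewrite (eq_big_nat _ _ (F2 := fun k => - (n%:R * lam * (full n k.+1 x)%:R)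
    - - (n%:R * lam * (full n k x)%:R))); last first.
  move=> k _.
  rewrite opprK addrC -mulrBr arrival_rateE fullS ltn_neqAle xn andbT.
  by congr (_ * _); case: full; case: eqP; rewrite ?subrr ?subr0.
by rewrite telescope_sumr// not_full// mulr0 oppr0 sub0r opprK.
Qed.

(** Telescoping of [x k - x k.+1], with last coordinate 0. *)
Lemma sum_departure_rate x i : jsq_space n x ->
  \sum_(0 <= k < (horizon x).+1 | (i <= k)%N) departure_rate x k =
  (x i)%:R :> R.
Proof.
move=> Sx; have xH := horizonP Sx.
rewrite -(big_nat_widenl i 0 _ xpredT)//.
have [iH|Hi] := leqP i (horizon x).+1; last first.
  by rewrite big_geq ?xH// 1?ltnW// ltnW.
rewrite (eq_big_nat _ _ (F2 := fun k => - (x k.+1)%:R - - (x k)%:R));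
  last first.
  by move=> k _; rewrite opprK addrC.
by rewrite telescope_sumr// xH ?leqnSn// oppr0 sub0r opprK.
Qed.

Lemma jsq_exit_rateE x : jsq_space n x ->
  jsq_exit_rate n lam x = n%:R * lam + (x 0%N)%:R.
Proof.
move=> Sx; rewrite /jsq_exit_rate (big_setT_ord _ (B := (horizon x).+1)).
  rewrite -(big_mkord xpredT
    (fun i => arrival_rate n lam x i + departure_rate x i)).
  rewrite big_split /=; congr (_ + _); last exact: (sum_departure_rate 0 Sx).
  rewrite (sum_arrival_rate 0 Sx) (_ : full n 0 x) ?mulr1//.
  exact/fullP.
move=> i Hi; rewrite arrival_rateE not_full//= mulr0 add0r.
by rewrite /departure_rate !(horizonP Sx) ?subrr// ltnW// ltnW.
Qed.

(** The listed moves carry the whole exit rate, as [tf_set_rate_cvg] requires. *)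
Lemma sum_jsq_neighbours_exit x : jsq_space n x ->
  \sum_(y <- jsq_neighbours x) jsq_rate n lam x y = jsq_exit_rate n lam x.
Proof.
move=> Sx; rewrite jsq_exit_rateE// sum_jsq_neighbours//.
rewrite (sum_arrival_rate 0 Sx) (sum_departure_rate 0 Sx).
by rewrite (_ : full n 0 x) ?mulr1//; exact/fullP.
Qed.

Definition tail_le i M : set jsq_state :=
  [set x | jsq_space n x /\ (tail i x <= M)%N].

Lemma rate_out_tail_le i M x : tail_le i M x ->
  \sum_(y <- jsq_neighbours x | y \in jsq_space n `\` tail_le i M)
    jsq_rate n lam x y =
  if tail i x == M then n%:R * lam * (full n i x)%:R else 0.
Proof.
move=> [Sx xM]; have xH := horizonP Sx.
(* A departure never raises the tail, so only arrivals leave the set. *)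
rewrite sum_jsq_neighbours// [X in _ + X]big1 ?addr0; last first.
  move=> k /set_mem[_] /not_andP nA.
  have [xk|/(departure_rate_eq0 Sx)//] := boolP (x k.+1 < x k)%N.
  case: nA => [[]|]; first exact: jsq_space_sub.
  move=> []; apply: leq_trans xM.
  by rewrite (tail_sub i xH (leq_ltn_trans (leq0n _) xk)) leq_addr.
rewrite -(sum_arrival_rate i Sx); case: eqP => xMe.
  rewrite big_mkcond [RHS]big_mkcond; apply: eq_bigr => k _.
  rewrite arrival_rateE.
  case: (boolP (full n k x && _)) => [/andP[xk xkn]|_]; last first.
    by rewrite mulr0 !if_same.
  congr (if _ then _ else _); apply/idP/idP => [/set_mem[Sy]|ik].
    move=> /not_andP[//|]; rewrite (tail_add _ _ xH) xMe.
    by case: (leqP i k) => // _; rewrite addn0 leqnn.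
  apply/mem_set; split; first exact: jsq_space_add.
  by move=> [_]; rewrite (tail_add _ _ xH) xMe ik addn1 ltnn.
(* From a tail below [M], one arrival reaches at most [M]. *)
rewrite big1// => k /set_mem[Sy] /not_andP[//|] []; rewrite (tail_add _ _ xH).
apply: leq_trans (leq_add (leqnn _) (leq_b1 _)) _.
by rewrite addn1 ltn_neqAle xM andbT; apply/eqP.
Qed.

(** Only departures lower the tail, and by at most one: entry is from level [M.+1], through a
    departure at a position at least [i]. *)
Lemma rate_into_tail_le i M x : (jsq_space n `\` tail_le i M) x ->
  \sum_(y <- jsq_neighbours x | y \in tail_le i M) jsq_rate n lam x y =
  if tail i x == M.+1 then (x i)%:R else 0.
Proof.
move=> [Sx /not_andP[//|/negP]]; rewrite -ltnNge => xM; have xH := horizonP Sx.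
rewrite sum_jsq_neighbours// big1 ?add0r; last first.
  move=> k /set_mem[_]; rewrite (tail_add _ _ xH) leqNgt.
  by rewrite ltn_addr.
rewrite -(sum_departure_rate i Sx); case: eqP => xMe.
  rewrite big_mkcond [RHS]big_mkcond; apply: eq_bigr => k _.
  have [xk|/(departure_rate_eq0 Sx) ->] := boolP (x k.+1 < x k)%N; last first.
    by rewrite !if_same.
  have := tail_sub i xH (leq_ltn_trans (leq0n _) xk); rewrite xMe => e.
  congr (if _ then _ else _); apply/idP/idP => [/set_mem[_ le]|ik].
    move: e; case: (leqP i k) => // _; rewrite addn0 => e.
    by rewrite -e ltnn in le.
  apply/mem_set; split; first exact: jsq_space_sub.
  by move: e; rewrite ik addn1 => -[->].
rewrite big1// => k /set_mem[_ le].
apply: (departure_rate_eq0 Sx); apply/negP => xk.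
have := tail_sub i xH (leq_ltn_trans (leq0n _) xk) => e; apply: xMe.
apply/eqP; rewrite eqn_leq xM andbT e -addn1.
exact: leq_add le (leq_b1 _).
Qed.

End JsqRates.

(** The almost-everywhere form is required because [Q] lies in the state space only almost
    surely. *)
Lemma ge0_integral_support d (Omega : measurableType d) (R : realType)
    (P : {measure set Omega -> \bar R}) (D : set Omega) (f : Omega -> \bar R) :
  measurable D -> measurable_fun setT f -> (forall w, 0 <= f w)%E ->
  {ae P, forall w, ~ D w -> f w = 0%E} ->
  (\int[P]_w f w = \int[P]_(w in D) f w)%E.
Proof.
move=> mD mf f0 fD; rewrite [RHS]integral_mkcond.
apply: ge0_ae_eq_integral => //.
- by apply/(measurable_restrictT _ mD); exact: measurable_funTS.
- by move=> w _; rewrite patchE; case: ifP.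
apply: filterS fD => w fw _; rewrite patchE; case: ifPn => //.
by rewrite notin_setE => /fw.
Qed.

(** * Expected queue coordinates in stationarity *)

Section JsqStationary.
Context (R : realType) (n : nat) (lam : R).
Context (p : R -> jsq_state -> jsq_state -> R) (mu : jsq_state -> R).
Context d (Omega : measurableType d) (P : probability Omega R).
Context (Q : Omega -> jsq_state).
Hypothesis n_gt0 : (0 < n)%N.
Hypothesis lam_ge0 : 0 <= lam.
Hypothesis p_chain : jsq_chain n lam p.
Hypothesis mu_stationary : stationary_distribution (jsq_space n) p mu.
Hypothesis Q_measurable :
  forall i, measurable_fun [set: Omega] (fun w => Q w i).
Hypothesis Q_law : forall x, jsq_space n x -> P [set w | Q w = x] = (mu x)%:E.
Local Open Scope ereal_scope.

Lemma measurable_coordinate i (f : nat -> \bar R) :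
  measurable_fun [set: Omega] (fun w => f (Q w i)).
Proof. by apply: measurableT_comp (Q_measurable i). Qed.

Lemma measurable_state x : measurable [set w | Q w = x].
Proof.
have -> : [set w | Q w = x] = \bigcap_i ((fun w => Q w i) @^-1` [set x i]).
  apply/seteqP; split=> [w <- //|w Qx]; apply/funext => i; exact: Qx.
apply: bigcapT_measurable => i; rewrite -[X in measurable X]setTI.
exact: Q_measurable.
Qed.

Lemma measurable_full i : measurable [set w | forall j, (j < i)%N -> Q w j = n].
Proof.
have -> : [set w | forall j, (j < i)%N -> Q w j = n] =
    \bigcap_j ((fun w => Q w j) @^-1` [set k | (j < i)%N -> k = n]).
  by apply/seteqP; split=> [w Qn j _ /=|w Qn j]; [exact: Qn|exact: (Qn j I)].
apply: bigcapT_measurable => j; rewrite -[X in measurable X]setTI.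
exact: Q_measurable.
Qed.

Definition level i M : set jsq_state :=
  [set x | jsq_space n x /\ tail i x = M].

Lemma measurable_jsq (A : set jsq_state) : A `<=` jsq_space n ->
  measurable (Q @^-1` A).
Proof.
apply: measurable_preimage_law => //; first exact: jsq_space_countable.
by move=> x _; exact: measurable_state.
Qed.

(** This is [flux_balance] for [tail_le n i M]: the outward rate is supported on level [M], the
    inward rate on level [M.+1]. *)
Lemma level_flux_balance i M :
  \int[P]_(w in Q @^-1` level i M) (n%:R * lam * (full n i (Q w))%:R)%:E =
  \int[P]_(w in Q @^-1` level i M.+1) (Q w i)%:R%:E.
Proof.
have [p_tf [p_jump p_exit]] := p_chain.
have N_rate x y : jsq_space n x -> y \in jsq_neighbours n x ->
    (p h x y / h)%R @[h --> 0^'+] --> jsq_rate n lam x y.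
  move=> Sx /(jsq_neighbours_space Sx)[Sy yx].
  by apply: p_jump => //; apply/eqP; rewrite eq_sym.
have N_exit x : jsq_space n x -> ((1 - p h x x) / h)%R @[h --> 0^'+] -->
    (\sum_(y <- jsq_neighbours n x) jsq_rate n lam x y)%R.
  by move=> Sx; rewrite sum_jsq_neighbours_exit//; exact: p_exit.
have exit_le x : jsq_space n x ->
    (\sum_(y <- jsq_neighbours n x) jsq_rate n lam x y <= n%:R * lam + n%:R)%R.
  move=> Sx; rewrite sum_jsq_neighbours_exit// jsq_exit_rateE// lerD2l ler_nat.
  by have [+ _ _] := Sx.
have AS : tail_le n i M `<=` jsq_space n by move=> x [].
have := flux_balance (jsq_space_countable n)
  (fun x _ => measurable_state x) Q_law p_tf mu_stationary
  (fun x _ => jsq_neighbours_uniq n x) (@jsq_neighbours_space n)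
  N_rate N_exit exit_le AS.
rewrite [LHS]integral_mkcond [RHS]integral_mkcond => e.
rewrite [LHS]integral_mkcond [RHS]integral_mkcond.
apply: etrans (etrans _ e) _.
  apply: eq_integral => w _; rewrite !patchE.
  case: ifPn => [/set_mem[Sx tx]|nl].
    have Ax : tail_le n i M (Q w) by split => //; rewrite tx.
    by rewrite (mem_set (A := Q @^-1` _) Ax) rate_out_tail_le// tx eqxx.
  case: ifPn => // /set_mem Ax; rewrite rate_out_tail_le//.
  by case: eqP => // tx; case/negP: nl; apply/mem_set; split => //; case: Ax.
apply: eq_integral => w _; rewrite !patchE.
case: ifPn => [/set_mem Bx|nB].
  rewrite rate_into_tail_le//; case: eqP => tx.
    by rewrite mem_set//; split => //; case: Bx.
  by case: ifPn => // /set_mem[].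
case: ifPn => // /set_mem[Sx tx]; case/negP: nB; apply/mem_set.
by split => // -[_]; rewrite tx ltnn.
Qed.

(** The reindexing [f] covers the sum over all levels and the sum over positive levels at once. *)
Lemma integral_levels i (f : nat -> nat) (g : jsq_state -> \bar R) :
  injective f -> (forall x, 0 <= g x) ->
  \int[P]_(w in Q @^-1` (\bigcup_M level i (f M))) g (Q w) =
  \sum_(M <oo) \int[P]_(w in Q @^-1` level i (f M)) g (Q w).
Proof.
move=> f_inj g0; rewrite preimage_bigcup ge0_integral_bigcup//.
- by move=> M; apply: measurable_jsq => x [].
- rewrite -preimage_bigcup; apply: measurable_fun_law.
  + exact: (jsq_space_countable n).
  + by move=> x _; exact: measurable_state.
  + by move=> x [M _ []].
- apply/trivIsetP => M K _ _ /eqP MK; apply/seteqP; split => // w.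
  by move=> [[_ tM] [_ tK]]; apply: MK; apply: f_inj; rewrite -tM.
Qed.

Lemma expected_coordinate i :
  \int[P]_w (Q w i)%:R%:E =
  (n%:R * lam)%:E * P [set w | forall j, (j < i)%N -> Q w j = n].
Proof.
have Q_ae : {ae P, forall w, jsq_space n (Q w)}.
  exact: (law_ae (jsq_space_countable n)
    (fun x _ => measurable_state x) Q_law (sd_sum1 mu_stationary)).
have nlam0 : (0 <= n%:R * lam)%R by rewrite mulr_ge0.
(* [D] omits level 0, where coordinate [i] vanishes. This shift pairs level [M.+1] on the left with
   level [M] on the right. *)
pose D := \bigcup_M level i M.+1; pose E := \bigcup_M level i M.
have mD : measurable (Q @^-1` D) by apply: measurable_jsq => x [M _ []].
have mE : measurable (Q @^-1` E) by apply: measurable_jsq => x [M _ []].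
have ind w : (n%:R * lam * (full n i (Q w))%:R)%:E =
    (n%:R * lam)%:E * (\1_[set w | forall j, (j < i)%N -> Q w j = n] w)%:E.
  rewrite -EFinM indicE; congr (_ * _%:R)%:E; congr nat_of_bool.
  by apply/fullP/idP => [h|/set_mem //]; exact/mem_set.
rewrite -[X in _ * P X]setIT -integral_indic//; last exact: measurable_full.
rewrite -ge0_integralZl//; last first.
  by apply/measurable_EFinP; exact: measurable_indic (measurable_full i).
under [RHS]eq_integral do rewrite -ind.
rewrite [LHS](ge0_integral_support mD)//; first last.
- apply: filterS Q_ae => w Sw nD; suff -> : Q w i = 0%N by [].
  apply: (tail_eq0 Sw).
  by case tw: (tail i (Q w)) => [//|M]; case: nD; exists M.
- exact: (measurable_coordinate i (fun k => k%:R%:E)).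
rewrite [RHS](ge0_integral_support mE)//; first last.
- by apply: filterS Q_ae => w Sw nE; case: nE; exists (tail i (Q w)).
- by move=> w; rewrite lee_fin mulr_ge0.
- under eq_fun do rewrite ind; apply: measurable_funeM.
  by apply/measurable_EFinP; exact: measurable_indic (measurable_full i).
rewrite (integral_levels (f := S) (g := fun x => (x i)%:R%:E) i)//;
  last exact: succn_inj.
rewrite (integral_levels (f := id)
  (g := fun x => (n%:R * lam * (full n i x)%:R)%:E) i)//; last first.
  by move=> x; rewrite lee_fin mulr_ge0.
by apply: eq_eseriesr => M _; rewrite level_flux_balance.
Qed.

End JsqStationary.

Theorem lemma2 (R : realType) (n : nat) (lam : R)
  (hn : (1 <= n)%N) (hlam0 : 0 < lam) (hlam1 : lam < 1)
  (p : R -> jsq_state -> jsq_state -> R) (hp : jsq_chain n lam p)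
  (mu : jsq_state -> R) (hmu : stationary_distribution (jsq_space n) p mu)
  (d : measure_display) (Omega : measurableType d) (P : probability Omega R)
  (Q : Omega -> jsq_state)
  (hQ_meas : forall i : nat, measurable_fun [set: Omega] (fun w => Q w i))
  (hQ_law : forall q, jsq_space n q -> P [set w | Q w = q] = (mu q)%:E) :
  ('E_P[fun w => (Q w 0%N)%:R] = (n%:R * lam)%:E)%E /\
  (forall i : nat, (0 < i)%N ->
    ('E_P[fun w => (Q w i)%:R]
     = (n%:R * lam)%:E * P [set w | forall j : nat, (j < i)%N -> Q w j = n])%E).
Proof.
have EQ := expected_coordinate hn (ltW hlam0) hp hmu hQ_meas hQ_law.
split=> [|i _]; rewrite unlock EQ//.
(* For coordinate 0 the condition on earlier coordinates is vacuous, so the event has probability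
   1. *)
rewrite (_ : [set w | _] = setT) ?probability_setT ?mule1//.
by apply/seteqP; split.
Qed.
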